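(* Let $(X,\mu)$ be a non-atomic measure space with a dyadic grid $\mathcal{D}$. Let $m\geq 2$, let $w_1,\dots,w_m$ be weights on $X$ and let $0<q_1,\dots,q_m<\infty$ be exponents such that $\prod_{i=1}^m w_i^{q_i}=1$. Then for every choice of exponents $0\leq\beta_1,\dots,\beta_m<\infty$ we have $$[\vec w]_{FW}^{\vec\beta}\lesssim[\vec w]^{\gamma\vec q}\qquad\text{with}\qquad \gamma=\max_{1\le i\le m}\beta_i/q_i.$$
   Context: Write $|E|=\mu(E)$ for measurable $E\subset X$. A dyadic grid is a (countable) collection $\mathcal{D}$ of measurable subsets of $X$ (''cubes'') with $0<|Q|<\infty$ such that for all $Q,Q'\in\mathcal{D}$ either $Q\subseteq Q'$, $Q'\subseteq Q$ or $Q\cap Q'=\emptyset$. A weight is a non-negative measurable function on $X$, and $(w)_Q=|Q|^{-1}\int_Q w\,d\mu$. For exponents $r_1,\dots,r_m\ge0$ let $\mathcal{M}^{\vec r}(f_1,\dots,f_m)(x)=\sup_{Q\in\mathcal{D},\,x\in Q}\prod_{i=1}^m\big(|Q|^{-1}\int_Q f_i\,d\mu\big)^{r_i}$; a factor with exponent $0$ is omitted. Multilinear Muckenhoupt characteristic: for $\vec q=(q_1,\dots,q_m)$ with $0\le q_i<\infty$, $[\vec w]^{\vec q}=\sup_{Q\in\mathcal{D}}\prod_{i=1}^m (w_i)_Q^{q_i}$, where $\vec w=(w_1,\dots,w_m)$. Here $\gamma\vec q=(\gamma q_1,\dots,\gamma q_m)$. Multilinear Fujii--Wilson characteristic: for $\vec\beta=(\beta_1,\dots,\beta_m)$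 with $0\le\beta_i<\infty$ and $\beta=\sum_i\beta_i$, $$[\vec w]_{FW}^{\vec\beta}=\sup_{Q\in\mathcal{D}}\Big(\int_Q \mathcal{M}^{\vec\beta/\beta}(1_Qw_1,\dots,1_Qw_m)\,d\mu\Big)^{\beta}\Big(\int_Q\prod_{i=1}^m w_i^{\beta_i/\beta}\,d\mu\Big)^{-\beta}$$ (if all $\beta_i=0$, this is read as $1$, consistently with the identity $([\vec w]_{FW}^{\vec\beta})^{a}=[\vec w]_{FW}^{a\vec\beta}$ for $0\le a<\infty$). $A\lesssim B$ means $A\le CB$ with $C$ depending only on $m,\vec q,\vec\beta$ (not on $X,\mu,\mathcal{D}$ or the weights). *)

(* Defs.v *)
From HB Require Import structures.
From mathcomp Require Import all_boot all_order all_algebra.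
From mathcomp Require Import all_classical all_reals all_analysis.
Set Implicit Arguments.
Unset Strict Implicit.
Unset Printing Implicit Defensive.
Import Order.TTheory GRing.Theory Num.Theory.
Import numFieldNormedType.Exports.
Local Open Scope classical_set_scope.
Local Open Scope ring_scope.
Local Open Scope ereal_scope.

Section defs.
Context {R : realType} {d : measure_display} {T : measurableType d}.
Variable mu : {measure set T -> \bar R}.

Definition non_atomic :=
  forall A : set T, measurable A -> 0 < mu A ->
    exists B : set T, [/\ measurable B, B `<=` A, 0 < mu B & mu B < mu A].

Record dyadic_grid (D : set (set T)) : Prop := DyadicGrid {
  grid_countable : countable D ;
  grid_measurable : forall Q, D Q -> measurable Q ;
  grid_pos : forall Q, D Q -> 0 < mu Q ;
  grid_fin : forall Q, D Q -> mu Q < +oo ;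
  grid_nested : forall Q Q', D Q -> D Q' ->
    [\/ Q `<=` Q', Q' `<=` Q | Q `&` Q' = set0] }.

Definition weight (w : T -> R) : Prop :=
  measurable_fun [set: T] w /\ forall x, (0 <= w x)%R.

Definition average (Q : set T) (f : T -> R) : \bar R :=
  (mu Q)^-1 * \int[mu]_(x in Q) (f x)%:E.

(* Supremum in [0, +oo]: unlike [ereal_sup], it is 0 on the empty set. *)
Definition nnsup (A : set (\bar R)) : \bar R := ereal_sup (0 |` A).

(* Since x `^ 0 = 1 for every x in [0, +oo], including 0 and +oo, the factors
   with exponent 0 are omitted from the products below. *)
Definition multimaximal (D : set (set T)) m (r : 'I_m -> R)
    (f : 'I_m -> T -> R) (x : T) : \bar R :=
  nnsup [set \prod_(i < m) (average Q (f i)) `^ (r i)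
        | Q in [set Q | D Q /\ Q x]].

Definition muckenhoupt (D : set (set T)) m (q : 'I_m -> R)
    (w : 'I_m -> T -> R) : \bar R :=
  nnsup [set \prod_(i < m) (average Q (w i)) `^ (q i) | Q in D].

(* The negative power of the second integral is written as a quotient, with
   0^-1 = +oo and +oo^-1 = 0, because [poweR] gives 0 `^ (- b) = 0 and
   +oo `^ (- b) = +oo. If all the exponents vanish, then each quotient is
   1 / 1 and the characteristic of a nonempty grid is 1. *)
Definition fujii_wilson (D : set (set T)) m (beta : 'I_m -> R)
    (w : 'I_m -> T -> R) : \bar R :=
  let b := (\sum_(i < m) beta i)%R in
  nnsup [set
    (\int[mu]_(x in Q)
       multimaximal D (fun i => beta i / b)%R
         (fun i y => \1_Q y * w i y)%R x) `^ b
    / (\int[mu]_(x in Q)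
         (\prod_(i < m) (w i x) `^ (beta i / b))%R%:E) `^ b
    | Q in D].

End defs.

(* Main.v *)
(* Put [b := \sum_i beta i], [r i := beta i / b], [u i := gamma * q i / b >= r i],
   [c i P := (w i)_P] and [a P := \prod_i c i P `^ r i]. Since
   [\prod_i w i `^ u i = 1], the function [v := \prod_i w i `^ r i] is the
   convex function [\prod_i w i `^ (r i - u i)] of the weights; its tangent at
   [2 * c i P] shows that [a P * |P| <= K \int_E v] for every [E] in [P] with
   [|E| >= |P| / 2], where [K] is a multiple of [[w]^{gamma q / b}].
   For a finite family of cubes in [P], the maximal ones with
   [c i R > 2 m c i P] for some [i] cover at most half of [P] by the weak-type
   estimate; off them the maximal function is at most [2 m a P], so that its
   integral is controlled by the integral of [v] over the uncovered part [E],
   and inside them one argues by induction on the size of the family. Monotone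
   convergence along an enumeration of the grid concludes. *)
Require Import Defs.
From HB Require Import structures.
From mathcomp Require Import all_boot all_order all_algebra.
From mathcomp Require Import all_classical all_reals all_analysis.
From mathcomp Require Import measurable_realfun ring lra.
Set Implicit Arguments.
Unset Strict Implicit.
Unset Printing Implicit Defensive.
Import Order.TTheory GRing.Theory Num.Theory.
Import numFieldNormedType.Exports.
Local Open Scope classical_set_scope.
Local Open Scope ring_scope.
Local Open Scope ereal_scope.

(** * Products of real powers *)

Section powR_products.
Context {R : realType} {I : finType}.
Implicit Types c s x : I -> R.
Local Open Scope ring_scope.

Lemma prod_powR_cst (a : R) s : 0 < a ->
  \prod_i a `^ s i = a `^ (\sum_i s i).
Proof.
move=> a0; by rewrite /powR gt_eqF// mulr_suml expR_sum.
Qed.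

Lemma prod_powRM c x s : (forall i, 0 <= c i) -> (forall i, 0 <= x i) ->
  \prod_i (c i * x i) `^ s i = \prod_i c i `^ s i * \prod_i x i `^ s i.
Proof.
by move=> c0 x0; rewrite -big_split/=; apply: eq_bigr => i _; rewrite powRM.
Qed.

Lemma prod_powRr x s (a : R) :
  (\prod_i x i `^ s i) `^ a = \prod_i x i `^ (s i * a).
Proof.
suff [_ ] : 0 <= \prod_i x i `^ s i /\
  (\prod_i x i `^ s i) `^ a = \prod_i x i `^ (s i * a) by [].
elim/big_rec2 : _ => [|i u v _ [v0 <-]]; first by rewrite powR1.
by rewrite mulr_ge0 ?powR_ge0// powRM ?powR_ge0// powRrM.
Qed.

(* The tangent inequality of the convex function
   [y |-> \prod_i y i `^ (- s i)] at [y = 1], with [y i = x i / c i]. *)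
Lemma prod_powRN_tangent c x s : (forall i, 0 < c i) -> (forall i, 0 < x i) ->
  (forall i, 0 <= s i) ->
  \prod_i c i `^ (- s i) * (1 + \sum_i s i) <=
  \prod_i x i `^ (- s i) +
  \prod_i c i `^ (- s i) * \sum_i s i * (x i / c i).
Proof.
move=> c0 x0 s0.
have -> : \prod_i x i `^ (- s i) =
    \prod_i c i `^ (- s i) * \prod_i (x i / c i) `^ (- s i).
  rewrite -prod_powRM => [| i | i]; last 2 first.
  - exact: ltW.
  - by rewrite divr_ge0// ltW.
  by apply: eq_bigr => i _; rewrite mulrCA mulfV ?mulr1// gt_eqF.
rewrite -mulrDr ler_wpM2l//; first by apply: prodr_ge0 => i _; exact: powR_ge0.
have -> : \prod_i (x i / c i) `^ (- s i) =
    expR (\sum_i - s i * ln (x i / c i)).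
  rewrite expR_sum; apply: eq_bigr => i _.
  by rewrite /powR gt_eqF// divr_gt0.
(* With [y i = x i / c i], two tangents are combined: [expR z >= 1 + z] at
   [z = - \sum_i s i * ln (y i)], then [ln (y i) <= y i - 1]. *)
apply: le_trans (lerD (expR_ge1Dx _) (lexx _)).
rewrite -addrA lerD2l -big_split/= ler_sum// => i _.
have y0 : 0 < x i / c i by rewrite divr_gt0.
have : ln (x i / c i) <= x i / c i - 1.
  by rewrite lerBrDl -{2}(@lnK _ (x i / c i)) ?expR_ge1Dx.
move=> h; rewrite -{1}[s i]mulr1 mulNr addrC -mulrBr ler_wpM2l//.
by move: h; lra.
Qed.

End powR_products.

(** * Maximal sets of finite nested families *)

Section disjoint_families.
Context {T : Type}.
Implicit Types (s t : seq (set T)) (A B : set T).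

Definition nested A B := [\/ A `<=` B, B `<=` A | A `&` B = set0].

Definition disjoint_family t := pairwise (fun A B => A `&` B == set0) t.

(** The sets are inserted one at a time. A new set contained in a selected one changes nothing;
    otherwise it replaces the selected sets that it contains, and by nestedness it is disjoint from
    the others. *)
Lemma maximal_subfamily s : {in s &, forall A B, nested A B} ->
  exists t, [/\ {subset t <= s}, disjoint_family t &
    forall A, A \in s -> exists2 B, B \in t & A `<=` B].
Proof.
elim: s => [|A s ih] ns; first by exists [::].
have [|t [ts dt st]] := ih.
  by move=> B C Bs Cs; apply: ns; rewrite in_cons ?Bs ?Cs orbT.
have [[B Bt AB]|nAt] := pselect (exists2 B, B \in t & A `<=` B).
  exists t; split => //.
    by move=> C /ts Cs; rewrite in_cons Cs orbT.
  by move=> C; rewrite in_cons => /orP[/eqP ->|/st//]; exists B.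
exists (A :: [seq B <- t | ~~ `[< B `<=` A >]]); split.
- move=> C; rewrite !in_cons mem_filter => /orP[->//|/andP[_ /ts ->]].
  by rewrite orbT.
- rewrite /disjoint_family pairwise_cons pairwise_filter// andbT.
  apply/allP => B; rewrite mem_filter => /andP[/asboolPn BA Bt].
  have [||AB|//|->//] := ns A B; rewrite ?in_cons ?eqxx ?(ts _ Bt) ?orbT//.
  by exfalso; apply: nAt; exists B.
- move=> C; rewrite in_cons => /orP[/eqP ->|/st[B Bt CB]].
    by exists A => //; rewrite in_cons eqxx.
  have [BA|BA] := pselect (B `<=` A).
    by exists A; [rewrite in_cons eqxx|exact: subset_trans BA].
  exists B => //; rewrite in_cons mem_filter Bt andbT.
  by apply/orP; right; apply/asboolPn.
Qed.

End disjoint_families.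

(** * Integrals over disjoint unions and of finite sums *)

Section integral_disjoint.
Context {d : measure_display} {T : measurableType d} {R : realType}.
Variable mu : {measure set T -> \bar R}.

Lemma ge0_integral_disjoint_family (t : seq (set T)) (f : T -> \bar R) :
  (forall A, A \in t -> measurable A) -> disjoint_family t ->
  measurable_fun [set: T] f -> (forall x, 0 <= f x) ->
  \int[mu]_(x in \big[setU/set0]_(A <- t) A) f x =
  \sum_(A <- t) \int[mu]_(x in A) f x.
Proof.
move=> mt dt mf f0; elim: t mt dt => [|A t ih] mt dt.
  by rewrite !big_nil integral_set0.
have mt' B : B \in t -> measurable B.
  by move=> Bt; apply: mt; rewrite in_cons Bt orbT.
move: dt; rewrite /disjoint_family pairwise_cons => /andP[/allP dA dt].
rewrite !big_cons ge0_integral_setU//.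
- by rewrite ih.
- by apply: mt; rewrite in_cons eqxx.
- by rewrite big_seq; apply: bigsetU_measurable.
- exact: measurable_funTS.
- rewrite disj_set2E big_distrr/= big_seq big1// => B /dA/eqP.
  by [].
Qed.

Lemma emeasurable_sum_seq (I : eqType) (t : seq I) (f : I -> T -> \bar R) :
  (forall i, i \in t -> measurable_fun [set: T] (f i)) ->
  measurable_fun [set: T] (fun x => \sum_(i <- t) f i x).
Proof.
elim: t => [_|i t ih mf].
  by under eq_fun do rewrite big_nil; exact: measurable_cst.
under eq_fun do rewrite big_cons; apply: emeasurable_funD.
  by apply: mf; rewrite in_cons eqxx.
by apply: ih => j jt; apply: mf; rewrite in_cons jt orbT.
Qed.

Lemma ge0_integral_sum_seq (A : set T) (I : eqType) (t : seq I)
    (f : I -> T -> \bar R) : measurable A ->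
  (forall i, i \in t -> measurable_fun [set: T] (f i)) ->
  (forall i x, 0 <= f i x) ->
  \int[mu]_(x in A) (\sum_(i <- t) f i x) =
  \sum_(i <- t) \int[mu]_(x in A) f i x.
Proof.
move=> mA mf f0; elim: t mf => [_|i t ih mf].
  by rewrite big_nil; under eq_integral do rewrite big_nil; rewrite integral0.
have mt j : j \in t -> measurable_fun [set: T] (f j).
  by move=> jt; apply: mf; rewrite in_cons jt orbT.
rewrite big_cons -ih// -ge0_integralD//.
- by apply: eq_integral => x _; rewrite big_cons.
- by apply: measurable_funTS; apply: mf; rewrite in_cons eqxx.
- by move=> x _; exact: sume_ge0.
- by apply: measurable_funTS; exact: emeasurable_sum_seq.
Qed.

End integral_disjoint.

(** * The stopping argument for finite families of cubes *)

Section sparse_domination.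
Context {d : measure_display} {T : measurableType d} {R : realType}.
Variables (mu : {measure set T -> \bar R}) (D : set (set T)).
Variables (m : nat) (w : 'I_m -> T -> R) (c : 'I_m -> set T -> R).
Variables (r : 'I_m -> R) (v : T -> \bar R) (K : R).
Hypothesis m_gt0 : (0 < m)%N.
Hypothesis gridD : dyadic_grid mu D.
Hypothesis weight_w : forall i, weight (w i).
Hypothesis c_gt0 : forall i A, D A -> (0 < c i A)%R.
Hypothesis int_w : forall i A, D A ->
  \int[mu]_(x in A) (w i x)%:E = (c i A)%:E * mu A.
Hypothesis r_ge0 : forall i, (0 <= r i)%R.
Hypothesis sum_r : (\sum_i r i = 1)%R.
Hypothesis mv : measurable_fun [set: T] v.
Hypothesis v_ge0 : forall x, 0 <= v x.

Let a (A : set T) : R := (\prod_i c i A `^ r i)%R.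

(** The only link between the averages and [v]; [ainfty_estimate] below supplies it. *)
Hypothesis ainfty : forall P E, D P -> measurable E -> E `<=` P ->
  2^-1%:E * mu P <= mu E -> (a P)%:E * mu P <= K%:E * \int[mu]_(x in E) v x.

(** The coefficient [b] is kept general: it is [a] here, and later also the product of the averages
    of the weights cut off to a cube. The initial value 0 matches the extra 0 in [nnsup]. *)
Definition maximal_seq (b : set T -> R) (s : seq (set T)) (x : T) : \bar R :=
  \big[maxe/0]_(A <- s) (b A * \1_A x)%:E.

Lemma measurable_maximal_seq b s : (forall A, A \in s -> measurable A) ->
  measurable_fun [set: T] (maximal_seq b s).
Proof.
rewrite /maximal_seq; elim: s => [_|A s ih ms].
  by under eq_fun do rewrite big_nil; exact: measurable_cst.
under eq_fun do rewrite big_cons; apply: measurable_maxe.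
  apply/measurable_EFinP; apply: measurable_funM => //.
  by apply: measurable_indic; apply: ms; rewrite in_cons eqxx.
by apply: ih => B Bs; apply: ms; rewrite in_cons Bs orbT.
Qed.

Lemma maximal_seq_ge0 b s x : 0 <= maximal_seq b s x.
Proof.
rewrite /maximal_seq; elim: s => [|A s ih]; first by rewrite big_nil.
by rewrite big_cons le_max ih orbT.
Qed.

Lemma maximal_seq_le b s x y : 0 <= y ->
  (forall A, A \in s -> A x -> (b A)%:E <= y) -> maximal_seq b s x <= y.
Proof.
move=> y0 h; rewrite /maximal_seq big_seq.
elim/big_ind : _ => // [u u' uy u'y|A As]; first by rewrite ge_max uy.
rewrite indicE; have [/set_mem Ax|_] := boolP (x \in A).
  by rewrite mulr1; exact: h.
by rewrite mulr0.
Qed.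

Lemma le_maximal_seq b s x A : A \in s -> A x -> (b A)%:E <= maximal_seq b s x.
Proof.
rewrite /maximal_seq; elim: s => [//|B s ih].
rewrite in_cons big_cons le_max => /orP[/eqP <- Ax|As Ax].
  by rewrite indicE mem_set// mulr1 lexx.
by rewrite ih ?orbT.
Qed.

(** In the threshold [2 * m], the factor [m] pays for the choice of the weight and the factor 2
    leaves half of [P] uncovered. *)
Let stop P A : bool := [exists i, (m%:R *+ 2 * c i P < c i A)%R].

Let a_gt0 A : D A -> (0 < a A)%R.
Proof. by move=> DA; apply: prodr_gt0 => i _; rewrite powR_gt0 ?c_gt0. Qed.

(** As the exponents [r i] add up to 1, the common factor [2 * m] leaves the product with exponent
    1. *)
Let nonstop P A : D P -> D A -> ~~ stop P A -> (a A <= m%:R *+ 2 * a P)%R.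
Proof.
move=> DP DA /existsPn nst.
have m2 : (0 < m%:R *+ 2 :> R)%R by rewrite pmulrn_lgt0// ltr0n.
have -> : (m%:R *+ 2 * a P = \prod_i (m%:R *+ 2 * c i P) `^ r i)%R.
  rewrite prod_powRM => [|i|i]; [|exact: ltW|by rewrite ltW ?c_gt0].
  by rewrite prod_powR_cst// sum_r powRr1// ltW.
apply: ler_prod => i _; rewrite powR_ge0/= ge0_ler_powR//.
- by rewrite nnegrE ltW ?c_gt0.
- by rewrite nnegrE mulr_ge0 ?ltW ?c_gt0.
- by rewrite leNgt nst.
Qed.

Let mw i : measurable_fun [set: T] (fun x => (w i x)%:E).
Proof. by apply/measurable_EFinP; case: (weight_w i). Qed.

Let w_ge0 i x : (0 <= w i x)%R. Proof. by case: (weight_w i). Qed.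

Let finD A : D A -> mu A \is a fin_num.
Proof. by move=> DA; rewrite ge0_fin_numE// (grid_fin gridD). Qed.

(* The cubes that stop at [P] are those on which the average of
   [\sum_i w i / c i P] exceeds [2 * m], where its average over [P] is [m]. *)
Let stop_small P t : D P -> disjoint_family t ->
  (forall A, A \in t -> [/\ D A, A `<=` P & stop P A]) ->
  mu (\big[setU/set0]_(A <- t) A) <= 2^-1%:E * mu P.
Proof.
move=> DP dt ht.
have mP := grid_measurable gridD DP.
have mt A : A \in t -> measurable A.
  by move=> /ht[DA _ _]; exact: grid_measurable gridD _ DA.
set U := \big[setU/set0]_(A <- t) A.
have mU : measurable U by rewrite /U big_seq; exact: bigsetU_measurable.
have UP : U `<=` P.
  rewrite /U big_seq; elim/big_ind : _ => // [B C BP CP|A /ht[]//].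
  by rewrite subUset.
pose g x : \bar R := \sum_i (c i P)^-1%:E * (w i x)%:E.
have g0 x : 0 <= g x.
  apply: sume_ge0 => i _; rewrite mule_ge0// lee_fin ?w_ge0//.
  by rewrite invr_ge0 ltW ?c_gt0.
have mg : measurable_fun [set: T] g.
  by apply: emeasurable_sum => i; exact: measurable_funeM.
have intg A : D A ->
    \int[mu]_(x in A) g x = \sum_i (c i A / c i P)%:E * mu A.
  move=> DA; have mA := grid_measurable gridD DA.
  have mwA i : measurable_fun A (fun x => (w i x)%:E) by exact: measurable_funTS.
  rewrite ge0_integral_sum//; last 2 first.
  - by move=> i; exact: measurable_funeM.
  - move=> i x _; rewrite mule_ge0// lee_fin ?w_ge0//.
    by rewrite invr_ge0 ltW ?c_gt0.
  apply: eq_bigr => i _; rewrite ge0_integralZl//.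
  - by rewrite int_w// muleA -EFinM mulrC.
  - by move=> x _; rewrite lee_fin w_ge0.
  - by rewrite lee_fin invr_ge0 ltW ?c_gt0.
have gP : \int[mu]_(x in P) g x = m%:R%:E * mu P.
  rewrite intg// -(fineK (finD DP)).
  under eq_bigr do rewrite divff ?gt_eqF ?c_gt0// -EFinM mul1r.
  by rewrite sumEFin big_const_ord iter_addr_0 -EFinM mulr_natl.
(* The single weight that makes [A] stop already gives [2 * m]; the other terms are nonnegative. *)
have gA A : A \in t -> (m%:R *+ 2)%:E * mu A <= \int[mu]_(x in A) g x.
  move=> /ht[DA _ /existsP[i iA]]; rewrite intg// (bigD1 i)//=.
  apply: le_trans (leeDl _ _); last first.
    apply: sume_ge0 => j _; rewrite mule_ge0// lee_fin.
    by rewrite divr_ge0 ?ltW ?c_gt0.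
  by rewrite lee_wpmul2r// lee_fin ler_pdivlMr ?c_gt0// ltW.
have : (m%:R *+ 2)%:E * mu U <= m%:R%:E * mu P.
  have gUP : \int[mu]_(x in U) g x <= \int[mu]_(x in P) g x.
    by apply: ge0_subset_integral => //; exact: measurable_funTS.
  rewrite -gP; apply: le_trans gUP.
  rewrite ge0_integral_disjoint_family//.
  have -> : mu U = \sum_(A <- t) mu A.
    have := ge0_integral_disjoint_family mu mt dt (f := cst 1).
    rewrite integral_cst// mul1e => ->//.
    by apply: eq_big_seq => A At; rewrite integral_cst ?mul1e//; exact: mt.
  rewrite ge0_sume_distrr// big_seq [leRHS]big_seq.
  by apply: lee_sum => A /gA.
have UPle : mu U <= mu P by apply: le_measure; rewrite ?inE.
have finU : mu U \is a fin_num.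
  by rewrite ge0_fin_numE// (le_lt_trans UPle)// (grid_fin gridD).
rewrite -(fineK (finD DP)) -(fineK finU) -!EFinM !lee_fin => h.
have m0 : (0 < m%:R :> R)%R by rewrite ltr0n.
rewrite -(ler_pM2l m0); move: h; rewrite mulr2n.
by lra.
Qed.

(** The top cube stands apart from the list, so that below a stopping cube the list gets strictly
    shorter. The constant does not grow in the induction, because the uncovered part and the maximal
    stopping cubes are disjoint and their integrals of [v] add up. *)
Lemma sparse_domination P s : D P ->
  (forall A, A \in s -> D A /\ A `<=` P) ->
  \int[mu]_(x in P) maximal_seq a (P :: s) x <=
  (m%:R *+ 2 * K)%:E * \int[mu]_(x in P) v x.
Proof.
have m2 : (0 <= m%:R *+ 2 :> R)%R by rewrite mulrn_wge0.
have [n] := ubnP (size s); elim: n => [//|n ih] in P s * => sn DP sP.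
have mP := grid_measurable gridD DP.
(* [t] consists of the maximal stopping cubes; [U] below is their union. *)
have [t [ts dt st]] : exists t, [/\ {subset t <= [seq A <- s | stop P A]},
    disjoint_family t &
    forall A, A \in [seq A <- s | stop P A] -> exists2 B, B \in t & A `<=` B].
  apply: maximal_subfamily => A B; rewrite !mem_filter.
  move=> /andP[_ /sP[DA _]] /andP[_ /sP[DB _]].
  exact: grid_nested gridD _ _ DA DB.
have ht A : A \in t -> [/\ A \in s, D A, A `<=` P & stop P A].
  by move=> /ts; rewrite mem_filter => /andP[? As]; have [] := sP _ As.
have mt A : A \in t -> measurable A.
  by move=> /ht[_ DA _ _]; exact: grid_measurable gridD _ DA.
pose U := \big[setU/set0]_(A <- t) A.
have mU : measurable U by rewrite /U big_seq; exact: bigsetU_measurable.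
have UP : U `<=` P.
  rewrite /U big_seq; elim/big_ind : _ => // [B C BP CP|A /ht[]//].
  by rewrite subUset.
have mE : measurable (P `\` U) by exact: measurableD.
have muU : mu U <= 2^-1%:E * mu P by apply: stop_small => // A /ht[].
have muE : 2^-1%:E * mu P <= mu (P `\` U).
  have Ufin : mu U \is a fin_num.
    rewrite ge0_fin_numE// (le_lt_trans muU)// -(fineK (finD DP)).
    by rewrite -EFinM ltry.
  have -> : mu (P `\` U) = (fine (mu P) - fine (mu U))%:E.
    rewrite EFinB (fineK (finD DP)) (fineK Ufin) measureD ?(setIidr UP)//.
    exact: grid_fin gridD _ DP.
  move: muU; rewrite -(fineK Ufin) -(fineK (finD DP)) -!EFinM !lee_fin.
  by rewrite /=; lra.
pose sub A := [seq B <- s | `[< B `<=` A >] && (B != A)].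
have ihA A : A \in t -> \int[mu]_(x in A) maximal_seq a (A :: sub A) x <=
    (m%:R *+ 2 * K)%:E * \int[mu]_(x in A) v x.
  move=> /ht[As DA AP _]; apply: ih => //.
    (* [sub A] is shorter than [s] since it leaves out [A], which belongs to [s]. *)
    rewrite -ltnS; apply: leq_trans sn; rewrite ltnS size_filter.
    rewrite -(count_predC (fun B => `[< B `<=` A >] && (B != A))) -addn1.
    rewrite leq_add2l -has_count; apply/hasP; exists A => //=.
    by rewrite eqxx andbF.
  move=> B; rewrite mem_filter => /andP[/andP[/asboolP BA _] /sP[DB _]].
  by [].
have msub A : A \in t ->
    measurable_fun [set: T] (maximal_seq a (A :: sub A)).
  move=> At; apply: measurable_maximal_seq => B.
  rewrite in_cons mem_filter => /orP[/eqP ->|/andP[_ /sP[DB _]]].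
    exact: mt.
  exact: grid_measurable gridD _ DB.
pose h x := \sum_(A <- t) (maximal_seq a (A :: sub A) \_ A) x.
have h0 x : 0 <= h x.
  by apply: sume_ge0 => A _; apply: erestrict_ge0 => y _;
    exact: maximal_seq_ge0.
have mres A : A \in t ->
    measurable_fun [set: T] (maximal_seq a (A :: sub A) \_ A).
  move=> At; apply/(measurable_restrictT _ _).1; first exact: mt.
  by apply: measurable_funTS; exact: msub.
have res0 A x : 0 <= (maximal_seq a (A :: sub A) \_ A) x.
  by apply: erestrict_ge0 => y _; exact: maximal_seq_ge0.
have mh : measurable_fun [set: T] h by exact: emeasurable_sum_seq.
(* The cube [P] and the cubes that do not stop are bounded by the constant. A stopping cube lies in
   some [B] of [t], where it is [B] itself or a member of [sub B], hence is bounded by [h]. *)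
have Mh x : P x -> maximal_seq a (P :: s) x <= (m%:R *+ 2 * a P)%:E + h x.
  move=> Px; have aP0 := ltW (a_gt0 DP).
  apply: maximal_seq_le => [|A].
    by rewrite adde_ge0// lee_fin mulr_ge0.
  rewrite in_cons => /orP[/eqP ->{A} _|As Ax].
    rewrite -[leLHS]adde0 leeD// lee_fin ler_peMl//.
    by rewrite -mulr_natr -natrM ler1n muln_gt0 m_gt0.
  have [DA _] := sP _ As.
  have [sA|nsA] := boolP (stop P A); last first.
    by rewrite -[leLHS]adde0 leeD// lee_fin nonstop.
  have [|B Bt AB] := st A; first by rewrite mem_filter sA.
  rewrite -[leLHS]add0e leeD// ?lee_fin ?mulr_ge0//.
  rewrite /h (big_rem B)//= -[leLHS]adde0 leeD//; last first.
    by apply: sume_ge0 => C _; apply: erestrict_ge0 => y _; exact: maximal_seq_ge0.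
  rewrite patchE mem_set; last exact: AB.
  apply: le_maximal_seq => //; rewrite in_cons mem_filter As andbT.
  by have [//|_] /= := eqVneq A B; rewrite andbT; exact/asboolP.
have mM : measurable_fun [set: T] (maximal_seq a (P :: s)).
  apply: measurable_maximal_seq => B.
  rewrite in_cons => /orP[/eqP ->//|/sP[DB _]].
  exact: grid_measurable gridD _ DB.
apply: (@le_trans _ _ (\int[mu]_(x in P) ((m%:R *+ 2 * a P)%:E + h x))).
  apply: ge0_le_integral => //.
  - by move=> x _; exact: maximal_seq_ge0.
  - exact: measurable_funTS.
  - by apply: emeasurable_funD => //; exact: measurable_funTS.
rewrite ge0_integralD//; last 2 first.
- by move=> x _; rewrite lee_fin mulr_ge0// ltW ?a_gt0.
- exact: measurable_funTS.
rewrite integral_cst//.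
have -> : \int[mu]_(x in P) h x =
    \sum_(A <- t) \int[mu]_(x in A) maximal_seq a (A :: sub A) x.
  rewrite ge0_integral_sum_seq//; apply: eq_big_seq => A /ht[_ _ AP _].
  by rewrite -integral_mkcondr (setIidr AP).
have -> : \int[mu]_(x in P) v x =
    \int[mu]_(x in P `\` U) v x + \int[mu]_(x in U) v x.
  rewrite -ge0_integral_setU//.
  - by rewrite setUC setDUK.
  - exact: measurable_funTS.
  - by rewrite disj_set2E setIC setDIK.
rewrite ge0_muleDr; last 2 first.
- exact: integral_ge0.
- exact: integral_ge0.
apply: leeD.
  (* The constant term is absorbed by the uncovered part, via [ainfty] with [E] equal to [P] minus
     [U]; the induction hypothesis then handles each stopping cube. *)
  rewrite 2!EFinM -!muleA lee_wpmul2l ?lee_fin//.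
  by apply: ainfty => //; exact: subDsetl.
rewrite ge0_integral_disjoint_family// ge0_sume_distrr; last first.
  by move=> A _; exact: integral_ge0.
by rewrite big_seq [leRHS]big_seq; apply: lee_sum => A /ihA.
Qed.

End sparse_domination.

(** * The lower bound for the integral of [v] on large subsets *)

Lemma prod_powR1_gt0 (R : realType) (I : finType) (x u : I -> R) :
  (forall i, 0 <= x i)%R -> (forall i, 0 < u i)%R ->
  (\prod_i x i `^ u i = 1)%R -> forall i, (0 < x i)%R.
Proof.
move=> x0 u0 x1 i; rewrite lt_neqAle x0 andbT; apply/negP => /eqP xi0.
move: x1; rewrite (bigD1 i)//= -xi0 powR0 ?gt_eqF// mul0r => /esym/eqP.
by rewrite oner_eq0.
Qed.

Section ainfty.
Context {d : measure_display} {T : measurableType d} {R : realType}.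
Variables (mu : {measure set T -> \bar R}) (m : nat) (w : 'I_m -> T -> R).
Variables (r u : 'I_m -> R).
Hypothesis weight_w : forall i, weight (w i).
Hypothesis u_gt0 : forall i, (0 < u i)%R.
Hypothesis r_le_u : forall i, (r i <= u i)%R.
Hypothesis prod_w1 : {ae mu, forall x, (\prod_i w i x `^ u i = 1)%R}.

Let v (x : T) : \bar R := (\prod_i w i x `^ r i)%:E.

Let s i : R := (u i - r i)%R.

Let s_ge0 i : (0 <= s i)%R. Proof. by rewrite subr_ge0. Qed.

Let mw i : measurable_fun [set: T] (fun x => (w i x)%:E).
Proof. by apply/measurable_EFinP; case: (weight_w i). Qed.

Let w_ge0 i x : (0 <= w i x)%R. Proof. by case: (weight_w i). Qed.

Lemma measurable_prod_powR : measurable_fun [set: T] v.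
Proof.
apply/measurable_EFinP; apply: measurable_prod => i _.
by apply: measurableT_comp (measurable_powR _) _; case: (weight_w i).
Qed.

(** Where the first product on the right is 1, this turns [v] into a product of nonpositive powers,
    to which the tangent inequality applies. *)
Lemma prod_powR_sub (x : 'I_m -> R) : (forall i, 0 < x i)%R ->
  (\prod_i x i `^ r i =
   \prod_i x i `^ u i * \prod_i x i `^ (- s i))%R.
Proof.
move=> x0; rewrite -big_split/=; apply: eq_bigr => i _.
rewrite -powRD; last by rewrite (gt_eqF (x0 i)) implybT.
by congr (_ `^ _)%R; rewrite /s; ring.
Qed.

(** The tangent at [2 * c i] is integrated over [E]. The factor 2 halves the linear terms, which
    then cost [pc * S / 2 * |P|] against a gain of at least [pc * (1 + S) / 2 * |P|]; what remains
    is [pc / 2 * |P|]. *)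
Lemma ainfty_estimate (P E : set T) (c : 'I_m -> R) (B : R) :
  measurable P -> measurable E -> E `<=` P -> mu P < +oo ->
  2^-1%:E * mu P <= mu E ->
  (forall i, 0 < c i)%R ->
  (forall i, \int[mu]_(x in P) (w i x)%:E = (c i)%:E * mu P) ->
  (\prod_i c i `^ u i <= B)%R ->
  (\prod_i c i `^ r i)%:E * mu P <=
  (2 * 2 `^ (\sum_i (u i - r i)) * B)%:E * \int[mu]_(x in E) v x.
Proof.
move=> mP mE EP Pfin PE c0 intw cB.
set S := (\sum_i _)%R.
pose pc := (\prod_i (2 * c i) `^ (- s i))%R.
have c2 i : (0 < 2 * c i)%R by rewrite mulr_gt0.
have pc0 : (0 < pc)%R by apply: prodr_gt0 => i _; exact: powR_gt0.
have S0 : (0 <= S)%R by apply: sumr_ge0 => i _; exact: s_ge0.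
have k0 i : (0 <= pc * (s i / (2 * c i)))%R.
  by rewrite mulr_ge0 ?(ltW pc0)// divr_ge0// ltW.
pose g x : \bar R := \sum_i (pc * (s i / (2 * c i)))%:E * (w i x)%:E.
have gi0 i x : 0 <= (pc * (s i / (2 * c i)))%:E * (w i x)%:E.
  by rewrite mule_ge0// lee_fin.
have g0 x : 0 <= g x by exact: sume_ge0.
have mg : measurable_fun [set: T] g.
  by apply: emeasurable_sum => i; exact: measurable_funeM.
have v0 x : 0 <= v x.
  by rewrite lee_fin; apply: prodr_ge0 => i _; exact: powR_ge0.
have mv := measurable_prod_powR.
have tangent : {ae mu, forall x, E x -> (pc * (1 + S))%:E <= v x + g x}.
  move: prod_w1; apply: filterS => x wx1 _.
  (* A vanishing weight would make the product 0, as all [u i] are positive. *)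
  have wx0 := prod_powR1_gt0 (fun i => w_ge0 i x) u_gt0 wx1.
  rewrite /v /g prod_powR_sub// wx1 mul1r.
  under [X in _ + X]eq_bigr do rewrite -EFinM -mulrA.
  rewrite sumEFin -EFinD lee_fin -mulr_sumr.
  apply: le_trans (prod_powRN_tangent c2 wx0 s_ge0) _.
  rewrite lerD2l ler_wpM2l ?(ltW pc0)//.
  by apply: ler_sum => i _; rewrite mulrA mulrAC.
have intE : (pc * (1 + S))%:E * mu E <=
    \int[mu]_(x in E) v x + (pc * (S / 2))%:E * mu P.
  rewrite -integral_cst//.
  apply: (@le_trans _ _ (\int[mu]_(x in E) (v x + g x))).
    apply: ae_ge0_le_integral => //.
    - by move=> x _; rewrite lee_fin mulr_ge0 ?(ltW pc0)// addr_ge0.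
    - by move=> x _; rewrite adde_ge0.
    - by apply: emeasurable_funD; exact: measurable_funTS.
  rewrite ge0_integralD//; [|exact: measurable_funTS..].
  rewrite leeD2l//.
  apply: (@le_trans _ _ (\int[mu]_(x in P) g x)).
    by apply: ge0_subset_integral => //; exact: measurable_funTS.
  rewrite ge0_integral_sum//; last first.
    by move=> i; apply: measurable_funTS; exact: measurable_funeM.
  rewrite (eq_bigr (fun i => (pc * (s i / 2))%:E * mu P)) => [|i _].
    rewrite -ge0_sume_distrl => [|i _]; last first.
      by rewrite lee_fin mulr_ge0 ?(ltW pc0)// divr_ge0.
    by rewrite sumEFin -mulr_sumr -mulr_suml.
  rewrite ge0_integralZl//; last 3 first.
  - exact: measurable_funTS.
  - by move=> x _; rewrite lee_fin.
  - by rewrite lee_fin.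
  rewrite intw muleA -EFinM; congr (_%:E * _); have := c0 i => ci0.
  by field; rewrite gt_eqF.
have aB : (\prod_i c i `^ r i <= B * (2 `^ S * pc))%R.
  rewrite prod_powR_sub// ler_pM//.
  - by apply: prodr_ge0 => i _; exact: powR_ge0.
  - by apply: prodr_ge0 => i _; exact: powR_ge0.
  rewrite /pc prod_powRM => [|//|i]; last exact: ltW.
  rewrite prod_powR_cst// sumrN -/S mulrA -powRD; last by rewrite pnatr_eq0 implybT.
  by rewrite subrr powRr0 mul1r.
have B0 : (0 <= B)%R.
  by apply: le_trans cB; apply: prodr_ge0 => i _; exact: powR_ge0.
have fP : mu P \is a fin_num by rewrite ge0_fin_numE.
have muEP : mu E <= mu P by apply: le_measure; rewrite ?inE.
have fE : mu E \is a fin_num.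
  by rewrite ge0_fin_numE// (le_lt_trans muEP).
have half : (pc / 2)%:E * mu P <= \int[mu]_(x in E) v x.
  have : 0 <= \int[mu]_(x in E) v x by exact: integral_ge0.
  move: intE PE; rewrite -(fineK fP) -(fineK fE).
  case: (\int[mu]_(x in E) v x) => [y|_ _ _|_ _]; [|exact: leey|by []].
  rewrite -!EFinM -!EFinD !lee_fin => h1 h2 _.
  have : (pc * (1 + S) * (2^-1 * fine (mu P)) <= pc * (1 + S) * fine (mu E))%R.
    by rewrite ler_wpM2l// mulr_ge0 ?(ltW pc0)// addr_ge0.
  by move: h1; lra.
apply: (@le_trans _ _ ((2 * 2 `^ S * B)%:E * ((pc / 2)%:E * mu P))).
  rewrite muleA -EFinM lee_wpmul2r// lee_fin (le_trans aB)//.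
  by rewrite [leRHS](_ : _ = B * (2 `^ S * pc))%R//; field.
by rewrite lee_wpmul2l// lee_fin !mulr_ge0// powR_ge0.
Qed.

End ainfty.

(** * Suprema, products and powers in the extended reals *)

Lemma le_nnsup (R : realType) (A : set (\bar R)) x : A x -> x <= nnsup A.
Proof. by move=> Ax; apply: ereal_sup_ubound; right. Qed.

Lemma nnsup_le (R : realType) (A : set (\bar R)) y : 0 <= y ->
  (forall x, A x -> x <= y) -> nnsup A <= y.
Proof. by move=> y0 Ay; apply: ge_ereal_sup => x [->//|/Ay]. Qed.

Lemma nnsup_ge0 (R : realType) (A : set (\bar R)) : 0 <= nnsup A.
Proof. by apply: ereal_sup_ubound; left. Qed.

Lemma lee_prod (R : realType) (I : finType) (f g : I -> \bar R) :
  (forall i, 0 <= f i) -> (forall i, f i <= g i) ->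
  \prod_i f i <= \prod_i g i.
Proof.
move=> f0 fg.
suff [] : 0 <= \prod_i f i /\ \prod_i f i <= \prod_i g i by [].
elim/big_rec2 : _ => [|i x y _ [x0 xy]]; first by rewrite lexx.
by rewrite mule_ge0// lee_pmul.
Qed.

Lemma lee_poweR (R : realType) (x y : \bar R) (a : R) : (0 <= a)%R ->
  0 <= x -> x <= y -> x `^ a <= y `^ a.
Proof.
move=> a0 x0 xy; apply: gt0_ler_poweR => //; rewrite in_itv/= leey andbT//.
exact: le_trans xy.
Qed.

(** * From finite families to the whole grid *)

Section maximal_bound.
Context {d : measure_display} {T : measurableType d} {R : realType}.
Variables (mu : {measure set T -> \bar R}) (D : set (set T)).
Variables (m : nat) (w : 'I_m -> T -> R) (c : 'I_m -> set T -> R).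
Variables (r : 'I_m -> R) (v : T -> \bar R) (K : R).
Hypothesis m_gt0 : (0 < m)%N.
Hypothesis gridD : dyadic_grid mu D.
Hypothesis weight_w : forall i, weight (w i).
Hypothesis c_gt0 : forall i A, D A -> (0 < c i A)%R.
Hypothesis average_w : forall i A, D A -> average mu A (w i) = (c i A)%:E.
Hypothesis r_ge0 : forall i, (0 <= r i)%R.
Hypothesis sum_r : (\sum_i r i = 1)%R.
Hypothesis mv : measurable_fun [set: T] v.
Hypothesis v_ge0 : forall x, 0 <= v x.

Let a (A : set T) : R := (\prod_i c i A `^ r i)%R.

Hypothesis ainfty : forall P E, D P -> measurable E -> E `<=` P ->
  2^-1%:E * mu P <= mu E -> (a P)%:E * mu P <= K%:E * \int[mu]_(x in E) v x.

Lemma integral_average (A : set T) (f : T -> R) : D A ->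
  \int[mu]_(x in A) (f x)%:E = average mu A f * mu A.
Proof.
move=> DA; rewrite /average muleAC mulVe ?mul1e//.
- by rewrite gt_eqF// (grid_pos gridD).
- by rewrite ge0_fin_numE// (grid_fin gridD).
Qed.

Let inv_ge0 A : 0 <= (mu A)^-1. Proof. by rewrite inve_ge0. Qed.

Let w_ge0 i x : (0 <= w i x)%R. Proof. by case: (weight_w i). Qed.

Variable Q : set T.
Hypothesis DQ : D Q.

Let wQ i y := (\1_Q y * w i y)%R.

Let integral_wQ i A : \int[mu]_(x in A) (wQ i x)%:E =
  \int[mu]_(x in A `&` Q) (w i x)%:E.
Proof.
rewrite integral_mkcondr; apply: eq_integral => x _.
by rewrite patchE /wQ indicE; case: (x \in Q); rewrite ?mul1r ?mul0r.
Qed.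

Let average_ge0 A i : 0 <= average mu A (wQ i).
Proof.
rewrite mule_ge0//; apply: integral_ge0 => x _.
by rewrite lee_fin mulr_ge0.
Qed.

Let average_sub A i : D A -> A `<=` Q -> average mu A (wQ i) = (c i A)%:E.
Proof.
by move=> DA AQ; rewrite /average integral_wQ (setIidl AQ) -average_w.
Qed.

(** Enlarging a cube beyond [Q] leaves the integral of the cut-off weight unchanged and increases
    the measure. Hence cubes containing [Q] can be replaced by [Q] itself. *)
Let average_sup A i : D A -> Q `<=` A -> average mu A (wQ i) <= (c i Q)%:E.
Proof.
move=> DA QA; rewrite /average integral_wQ (setIidr QA) -average_w// /average.
have mQ := grid_measurable gridD DQ; have mA := grid_measurable gridD DA.
rewrite lee_wpmul2r//.
  by apply: integral_ge0 => x _; rewrite lee_fin.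
by rewrite lee_pV2 ?inE//; apply: le_measure; rewrite ?inE.
Qed.

Let average_disj A i : A `&` Q = set0 -> average mu A (wQ i) = 0.
Proof. by move=> AQ; rewrite /average integral_wQ AQ integral_set0 mule0. Qed.

Let p A : \bar R := \prod_i (average mu A (wQ i)) `^ (r i).

Let p_fin A : D A -> p A \is a fin_num.
Proof.
move=> DA; apply: prode_fin_num => i _; apply: fin_num_poweR.
rewrite ge0_fin_numE ?average_ge0//.
have [AQ|QA|AQ] := grid_nested gridD DA DQ.
- by rewrite average_sub// ltry.
- by rewrite (le_lt_trans (average_sup _ DA QA))// ltry.
- by rewrite average_disj.
Qed.

Let p_sub A : D A -> A `<=` Q -> p A = (a A)%:E.
Proof.
move=> DA AQ; rewrite /p /a -prodEFin; apply: eq_bigr => i _.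
by rewrite average_sub// poweR_EFin.
Qed.

Let p_sup A : D A -> Q `<=` A -> p A <= (a Q)%:E.
Proof.
move=> DA QA; rewrite /p /a -prodEFin; apply: lee_prod => i.
  exact: poweR_ge0.
by rewrite -poweR_EFin lee_poweR// average_sup.
Qed.

Lemma integral_multimaximal_le :
  \int[mu]_(x in Q) multimaximal mu D r wQ x <=
  (m%:R *+ 2 * K)%:E * \int[mu]_(x in Q) v x.
Proof.
have mQ := grid_measurable gridD DQ.
have [e De] : exists e : nat -> set T, D = range e.
  have /pfcard_geP[D0|/surjfunPex//] := grid_countable gridD.
  by move: DQ; rewrite D0.
have De' k : D (e k) by rewrite De; exists k.
pose b A := fine (p A).
pose M n := maximal_seq b (mkseq e n).
have bp A : D A -> (b A)%:E = p A by move=> DA; rewrite /b fineK ?p_fin.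
have eM n A : A \in mkseq e n -> D A by move=> /mapP[k _ ->].
have ndM x : {homo M^~ x : n k / (n <= k)%N >-> n <= k}.
  move=> n k nk; apply: maximal_seq_le; first exact: maximal_seq_ge0.
  move=> A /mapP[j]; rewrite mem_iota add0n => /andP[_ jn] -> Ax.
  apply: le_maximal_seq => //; apply/mapP; exists j => //.
  by rewrite mem_iota add0n (leq_trans jn).
have mM n : measurable_fun [set: T] (M n).
  by apply: measurable_maximal_seq => A /eM; exact: grid_measurable gridD _.
have -> : \int[mu]_(x in Q) multimaximal mu D r wQ x =
    \int[mu]_(x in Q) limn (M^~ x).
  apply: eq_integral => x _.
  rewrite (cvg_lim _ (ereal_nondecreasing_cvgn (ndM x)))//.
  apply/eqP; rewrite eq_le; apply/andP; split.
    apply: nnsup_le.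
      by apply: (le_trans (maximal_seq_ge0 b (mkseq e 0) x));
         apply: ereal_sup_ubound; exists 0%N.
    move=> _ [A [DA Ax] <-]; rewrite -/(p A) -bp//.
    move: (DA); rewrite {1}De => -[k _ ekA].
    (* [mkseq e n] stops at [e n.-1], so [e k] first occurs at stage [k.+1]. *)
    apply: (@le_trans _ _ (M k.+1 x)).
      apply: le_maximal_seq => //; apply/mapP; exists k => //.
      by rewrite mem_iota add0n ltnS leqnn.
    by apply: ereal_sup_ubound; exists k.+1.
  apply: ge_ereal_sup => _ [n _ <-]; apply: maximal_seq_le.
    exact: nnsup_ge0.
  move=> A /eM DA Ax; rewrite bp//; apply: le_nnsup.
  by exists A.
have mMQ n : measurable_fun Q (M n) by exact: measurable_funTS.
have M0 n x : Q x -> 0 <= M n x by move=> _; exact: maximal_seq_ge0.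
rewrite (monotone_convergence mu mQ mMQ M0 (fun x _ => ndM x)).
apply: lime_le.
  apply: ereal_nondecreasing_is_cvgn => n k nk.
  exact: (ge0_le_integral mu mQ (M0 n) (mMQ n) (mMQ k)
    (fun x _ => ndM x _ _ nk)).
near=> n.
pose s := [seq A <- mkseq e n | `[< A `<=` Q >]].
have sD A : A \in s -> D A /\ A `<=` Q.
  by rewrite mem_filter => /andP[/asboolP ? /eM].
have int_w i A : D A -> \int[mu]_(x in A) (w i x)%:E = (c i A)%:E * mu A.
  by move=> DA; rewrite integral_average// average_w.
have := sparse_domination m_gt0 gridD weight_w c_gt0 int_w r_ge0 sum_r mv
  v_ge0 ainfty DQ sD.
have mMs : measurable_fun Q (maximal_seq a (Q :: s)).
  apply: measurable_funTS; apply: measurable_maximal_seq => A.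
  rewrite in_cons => /orP[/eqP ->//|/sD[DA _]].
  exact: grid_measurable gridD _ DA.
apply: le_trans; apply: (ge0_le_integral mu mQ (M0 n) (mMQ n) mMs).
(* At a point of [Q], an enumerated cube inside [Q] belongs to [s], a cube containing [Q] is
   dominated by [Q], and a disjoint cube cannot occur. *)
move=> x Qx; apply: maximal_seq_le; first exact: maximal_seq_ge0.
move=> A An Ax; have DA := eM _ _ An; rewrite bp//.
have [AQ|QA|AQ] := grid_nested gridD DA DQ.
- rewrite p_sub//; apply: le_maximal_seq => //.
  by rewrite in_cons mem_filter An andbT; apply/orP; right; apply/asboolP.
- rewrite (le_trans (p_sup DA QA))//; apply: le_maximal_seq => //.
  by rewrite in_cons eqxx.
- by have : (A `&` Q) x by []; rewrite AQ.
Unshelve. all: by end_near.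
Qed.

End maximal_bound.

(** * Degenerate values, and the final assembly *)

Lemma prode_gt0_ltey (R : realType) (I : finType) (x : I -> \bar R) :
  (forall i, 0 < x i) -> \prod_i x i < +oo -> forall i, x i < +oo.
Proof.
move=> x0 xy i; rewrite ltey; apply/negP => /eqP xi.
move: xy; rewrite (bigD1 i)//= xi gt0_mulye ?ltxx//.
by elim/big_ind : _ => // y z y0 z0; rewrite mule_gt0.
Qed.

(** For [y = +oo] the quotient is 0, as [+oo^-1 = 0]; [0 < y] excludes the value [0^-1 = +oo]. *)
Lemma poweR_div_le (R : realType) (x y : \bar R) (k b : R) :
  (0 <= k)%R -> (0 < b)%R -> 0 <= x -> 0 < y -> x <= k%:E * y ->
  x `^ b / y `^ b <= (k `^ b)%:E.
Proof.
move=> k0 b0 x0 y0 xy.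
have [yoo|yoo] := eqVneq y +oo.
  by rewrite yoo poweRyr ?gt_eqF// invey mule0 lee_fin powR_ge0.
have yb0 : 0 < y `^ b by exact: poweR_gt0.
have ybfin : y `^ b \is a fin_num.
  by rewrite fin_num_poweR// ge0_fin_numE ?(ltW y0)// ltey.
apply: (@le_trans _ _ ((k%:E * y) `^ b / y `^ b)).
  by rewrite lee_wpmul2r ?inve_ge0 ?(ltW yb0)// lee_poweR// ltW.
rewrite poweRM ?(ltW y0)// -muleA divee ?gt_eqF// mule1.
by rewrite poweR_EFin.
Qed.

(** A zero integral would force [f = 0] almost everywhere on [A], so that [A] would be null. *)
Lemma average_gt0 d (T : measurableType d) (R : realType)
    (mu : {measure set T -> \bar R}) (A : set T) (f : T -> R) :
  measurable A -> 0 < mu A -> mu A < +oo -> weight f ->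
  {ae mu, forall x, (0 < f x)%R} -> 0 < average mu A f.
Proof.
move=> mA A0 Aoo [mf f0] fpos.
have mf' : measurable_fun A (fun x => (f x)%:E).
  by apply: measurable_funTS; exact/measurable_EFinP.
rewrite /average mule_gt0//.
  by rewrite inve_gt0 -?ltey // gt_eqF.
rewrite lt_neqAle; apply/andP; split; last first.
  by apply: integral_ge0 => x _; rewrite lee_fin.
apply/negP => /eqP int0.
have /(ae_eq_integral_abs mu mA mf') fae0 : \int[mu]_(x in A) `|(f x)%:E| = 0.
  by rewrite [RHS]int0; apply: eq_integral => x _; rewrite gee0_abs ?lee_fin.
have : {ae mu, forall x, ~ A x}.
  move: fpos fae0; apply: filterS2 => x fx fx0 Ax.
  by move: (fx0 Ax) => [fx0']; rewrite fx0' ltxx in fx.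
move=> [N [mN N0 AN]].
have : mu A <= mu N.
  by apply: le_measure; rewrite ?inE// => x Ax; apply: AN => /(_ Ax).
by rewrite N0 leNgt A0.
Qed.

Theorem lemma1p6 (R : realType) (m : nat) (q beta : 'I_m -> R)
    (hm : (2 <= m)%N)
    (hq : forall i, (0 < q i)%R)
    (hbeta : forall i, (0 <= beta i)%R) :
  exists C : R, (0 < C)%R /\
    forall (d : measure_display) (T : measurableType d)
      (mu : {measure set T -> \bar R}) (D : set (set T))
      (w : 'I_m -> T -> R),
      non_atomic mu ->
      dyadic_grid mu D ->
      (forall i, weight (w i)) ->
      {ae mu, forall x, (\prod_(i < m) (w i x) `^ (q i))%R = 1%R} ->
      let gamma := (\big[Num.max/0]_(i < m) (beta i / q i))%R in
      fujii_wilson mu D beta w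
        <= C%:E * muckenhoupt mu D (fun i => gamma * q i)%R w.
Proof.
set gamma := (\big[Num.max/0]_(i < m) (beta i / q i))%R.
pose b := (\sum_(i < m) beta i)%R.
pose u i := (gamma * q i / b)%R; pose r i := (beta i / b)%R.
pose C0 := (m%:R *+ 2 * (2 * 2 `^ (\sum_i (u i - r i))))%R.
have C00 : (0 <= C0)%R by rewrite mulr_ge0 ?mulrn_wge0// mulr_ge0// powR_ge0.
have Cb0 : (0 <= C0 `^ b)%R by exact: powR_ge0.
(* The summand 1 makes the constant at least 1, which settles the degenerate cases. *)
exists (C0 `^ b + 1)%R; split; first by rewrite ltr_wpDl.
move=> d T mu D w _ gridD ww w1 /=.
set C := (C0 `^ b + 1)%R; have C1 : (1 <= C)%R by rewrite lerDr.
set A := muckenhoupt _ _ _ _; have A0 : 0 <= A by exact: nnsup_ge0.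
have gammab i : (beta i <= gamma * q i)%R.
  by rewrite -ler_pdivrMr//; exact: le_bigmax.
have gamma0 : (0 <= gamma)%R.
  by apply: bigmax_ge_id.
have b0 : (0 <= b)%R by exact: sumr_ge0.
apply: nnsup_le; first by rewrite mule_ge0// lee_fin (le_trans _ C1).
move=> _ [Q DQ <-]; rewrite -/b.
(* If all [beta i] vanish then so does [gamma]; both characteristics are suprema of ones, and [Q]
   shows that the right one is at least 1. *)
have [b00|bneq0] := eqVneq b 0%R.
  have beta0 i : beta i = 0%R.
    by apply/eqP; move/eqP: b00; rewrite psumr_eq0// => /allP/(_ i); apply.
  have gamma00 : gamma = 0%R.
    rewrite /gamma; elim/big_ind : _ => // [x y -> ->|i _]; first by rewrite maxxx.
    by rewrite beta0 mul0r.
  rewrite b00 !poweRe0 inve1 mule1 (le_trans _ (lee_pemull _ _))//.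
  apply: le_nnsup; exists Q => //.
  by rewrite big1// => i _; rewrite gamma00 mul0r poweRe0.
have {bneq0}b_gt0 : (0 < b)%R by rewrite lt_neqAle eq_sym bneq0.
have gamma_gt0 : (0 < gamma)%R.
  rewrite lt_neqAle gamma0 andbT; apply/negP => /eqP g0; move: b_gt0.
  rewrite ltNge => /negP; apply; rewrite /b sumr_le0// => i _.
  by rewrite (le_trans (gammab i))// -g0 mul0r.
have [->|Aoo] := eqVneq A +oo.
  by rewrite gt0_muley ?leey// lte_fin (lt_le_trans _ C1).
have Afin : A \is a fin_num by rewrite ge0_fin_numE// ltey.
have A0' : (0 <= fine A)%R by rewrite fine_ge0.
have u_gt0 i : (0 < u i)%R by rewrite divr_gt0// mulr_gt0.
have r_le_u i : (r i <= u i)%R by rewrite ler_pM2r// invr_gt0.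
have r_ge0 i : (0 <= r i)%R by rewrite divr_ge0// ltW.
have sum_r : (\sum_i r i = 1)%R by rewrite -mulr_suml divff// gt_eqF.
have w_gt0 i : {ae mu, forall x, (0 < w i x)%R}.
  move: w1; apply: filterS => x wx1.
  by apply: (prod_powR1_gt0 _ hq wx1) => j; case: (ww j).
have wu1 : {ae mu, forall x, (\prod_i w i x `^ u i = 1)%R}.
  move: w1; apply: filterS => x wx1.
  under eq_bigr do rewrite /u [(gamma * _)%R]mulrC -mulrA.
  by rewrite -prod_powRr wx1 powR1.
have avg_gt0 i P : D P -> 0 < average mu P (w i).
  move=> DP; apply: average_gt0 => //.
  - exact: grid_measurable gridD _ DP.
  - exact: grid_pos gridD _ DP.
  - exact: grid_fin gridD _ DP.
have le_A P : D P ->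
    \prod_i (average mu P (w i)) `^ (gamma * q i) <= (fine A)%:E.
  by move=> DP; rewrite fineK//; apply: le_nnsup; exists P.
pose c i P : R := fine (average mu P (w i)).
(* The averages are positive, so an infinite one would make the whole product infinite, against the
   finiteness of [A]. *)
have avgE i P : D P -> average mu P (w i) = (c i P)%:E.
  move=> DP; rewrite /c fineK// ge0_fin_numE ?(ltW (avg_gt0 _ _ DP))//.
  apply: (@lty_poweRy _ _ (gamma * q i)); first by rewrite gt_eqF// mulr_gt0.
  apply: (prode_gt0_ltey (x := fun j => average mu P (w j) `^ (gamma * q j))) => [j|].
    by rewrite poweR_gt0// avg_gt0.
  by rewrite (le_lt_trans (le_A P DP))// ltry.
have c_gt0 i P : D P -> (0 < c i P)%R.
  by move=> DP; rewrite -lte_fin -avgE// avg_gt0.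
(* The exponents [u i] are [gamma * q i / b], so the bound [A] enters with the power [1 / b]. *)
pose B := (fine A `^ b^-1)%R.
have cB P : D P -> (\prod_i c i P `^ u i <= B)%R.
  move=> DP; rewrite /u -prod_powRr.
  rewrite ge0_ler_powR ?invr_ge0// ?nnegrE//.
    by apply: prodr_ge0 => i _; exact: powR_ge0.
  rewrite -lee_fin -prodEFin (le_trans _ (le_A P DP))// le_eqVlt.
  by apply/orP; left; apply/eqP; apply: eq_bigr => i _; rewrite avgE// poweR_EFin.
pose v (x : T) : \bar R := (\prod_i w i x `^ r i)%:E.
have v_ge0 x : 0 <= v x.
  by rewrite lee_fin; apply: prodr_ge0 => i _; exact: powR_ge0.
have mv : measurable_fun [set: T] v := measurable_prod_powR r ww.
pose K := (2 * 2 `^ (\sum_i (u i - r i)) * B)%R.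
have K0 : (0 <= K)%R by rewrite mulr_ge0 ?powR_ge0// mulr_ge0 ?powR_ge0.
have avg_int i P : D P -> \int[mu]_(x in P) (w i x)%:E = (c i P)%:E * mu P.
  by move=> DP; rewrite (integral_average gridD)// avgE.
have ainf P E : D P -> measurable E -> E `<=` P -> 2^-1%:E * mu P <= mu E ->
    (\prod_i c i P `^ r i)%:E * mu P <= K%:E * \int[mu]_(x in E) v x.
  move=> DP mE EP PE; apply: (ainfty_estimate ww u_gt0 r_le_u wu1 _ mE EP) => //.
  - exact: grid_measurable gridD _ DP.
  - exact: grid_fin gridD _ DP.
  - by move=> i; exact: c_gt0.
  - by move=> i; exact: avg_int.
  - exact: cB.
have main := integral_multimaximal_le (ltnW hm) gridD ww c_gt0 avgE r_ge0 sum_r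
  mv v_ge0 ainf DQ.
(* Otherwise [ainf] with [E = Q] would give a nonpositive value to a product of positive numbers. *)
have v_gt0 : 0 < \int[mu]_(x in Q) v x.
  rewrite lt_neqAle integral_ge0 ?andbT//; apply/negP => /eqP v0.
  have mQ := grid_measurable gridD DQ.
  have Qpos := grid_pos gridD DQ.
  have := ainf Q Q DQ mQ (@subset_refl _ Q); rewrite -v0 mule0 => h.
  have : (\prod_i c i Q `^ r i)%:E * mu Q <= 0.
    apply: h; rewrite -[leRHS]mul1e lee_wpmul2r// lee_fin; lra.
  apply/negP; rewrite -ltNge mule_gt0// lte_fin.
  by apply: prodr_gt0 => i _; rewrite powR_gt0 ?c_gt0.
apply: (@le_trans _ _ ((m%:R *+ 2 * K) `^ b)%:E).
  apply: poweR_div_le => //.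
  - by rewrite mulr_ge0 ?mulrn_wge0.
  - by apply: integral_ge0 => x _; exact: nnsup_ge0.
have -> : (m%:R *+ 2 * K = C0 * B)%R by rewrite /C0 /K !mulrA.
rewrite powRM ?powR_ge0// /B -powRrM mulVf ?gt_eqF// powRr1//.
by rewrite EFinM fineK// lee_wpmul2r// lee_fin lerDl.
Qed.
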